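(* Let $A_1,\dots,A_N$ be real $2\times 2$ matrices with $A_j=P_jJ_jP_j^{-1}$, $P_j$ real invertible, where $A_1$ is Hurwitz stable and $A_2,\dots,A_N$ are unstable, with $P_1,\dots,P_N$ chosen so that each $P_j^{-1}P_1=\begin{pmatrix}a_j&b_j\\c_j&d_j\end{pmatrix}$, $j=2,\dots,N$, has determinant $1$ or $-1$. Let $J_1=\mathrm{diag}(-p_1,-q_1)$ with $0<p_1\le q_1$. Let $k,\ell\ge0$ be integers with $k+\ell+1\le N$ and assume: for $2\le j\le k+1$, $J_j=\begin{pmatrix}\alpha_j&\beta_j\\-\beta_j&\alpha_j\end{pmatrix}$ with $\alpha_j\ge0$, $\beta_j\ne0$; for $k+1<j\le k+\ell+1$, $J_j=\begin{pmatrix}n_j&1\\0&n_j\end{pmatrix}$ with $n_j\ge0$; for $k+\ell+1<j\le N$, $J_j=\mathrm{diag}(p_j,q_j)$ with $p_j\le q_j$, $(p_j,q_j)\ne(0,0)$. For $\lambda>0$ and $\eta>0$ define: (a) for $2\le j\le k+1$, $$\tau_{1,2}^{(j)}(\lambda,\eta)=\frac{\alpha_j}{p_1}\eta+\frac1{p_1}\cosh^{-1}\left[\frac12\left((a_j^2+c_j^2)\lambda^2+\frac{b_j^2+d_j^2}{\lambda^2}\right)\right];$$ (b) for $k+1<j\le k+\ell+1$, $$\tau_{1,2}^{(j)}(\lambda,\eta)=\frac{n_j}{p_1}\eta+\frac1{p_1}\sinh^{-1}\left[\frac12\left(c_j^2\lambda^2+\frac{d_j^2}{\lambda^2}\right)\eta\right];$$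 (c) for $k+\ell+1<j\le N$, $\tau_{1,2}^{(j)}(\lambda,\eta)$ is the unique solution $\tau\ge\frac{q_j}{p_1}\eta$ of $$\sinh(p_1\tau-q_j\eta)\,\sinh(p_1\tau-p_j\eta)=\left(\frac{b_jd_j}{\lambda^2}+a_jc_j\lambda^2\right)^2\sinh^2\left(\frac{q_j-p_j}{2}\,\eta\right).$$ For given $\epsilon>0$, let $\tau(\eta)=\inf_{\lambda>0}\max\{\tau_{1,2}^{(2)}(\lambda,\eta),\dots,\tau_{1,2}^{(N)}(\lambda,\eta)\}$ if the infimum over $\lambda$ is attained, and $\tau(\eta)=\inf_{\lambda>0}\max\{\tau_{1,2}^{(2)}(\lambda,\eta),\dots,\tau_{1,2}^{(N)}(\lambda,\eta)\}+\epsilon$ otherwise. Then the switched system $\dot x(t)=A_{\sigma(t)}x(t)$ is stable for all $\sigma\in\mathcal S_N[\tau(\eta),\eta]$ and asymptotically stable for all $\sigma\in\mathcal S_N'[\tau(\eta),\eta]$.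
   Context: Hurwitz stable: all eigenvalues have negative real part; unstable: at least one eigenvalue has positive real part. The system is $\dot x(t)=A_{\sigma(t)}x(t)$, $x(t)\in\mathbb R^2$ continuous in $t\ge0$. A switching signal $\sigma:[0,\infty)\to\{1,\dots,N\}$ is right-continuous and piecewise constant with infinitely many discontinuities $0<d_1<d_2<\cdots$, $d_k\to\infty$, $d_0=0$; it is governed by the undirected star graph with internal node $A_1$ and leaves $A_2,\dots,A_N$, i.e. with $\sigma(0)=1$ one has $\sigma(d_{2k})=1$ for all $k\ge0$ and $\sigma(d_{2k-1})\in\{2,\dots,N\}$ for all $k\ge1$. Put $t_k=d_{2k-1}-d_{2k-2}$ (time spent in $A_1$) and $s_k=d_{2k}-d_{2k-1}$ (time spent in another subsystem), $k\ge1$. $\mathcal S_N[\tau,\eta]$ is the set of such signals with $\sigma(0)=1$, $t_k\ge\tau$, $s_k\le\eta$ for all $k\in\mathbb N$; $\mathcal S_N'[\tau,\eta]$ is the set of $\sigma\in\mathcal S_N[\tau,\eta]$ for which $(t_k,s_k)_{k\ge1}$ does not converge to $(\tau,\eta)$. For a given signal, the system is stable if for every $\varepsilon'>0$ there is $\delta>0$ such that $\|x(0)\|<\delta$ implies $\|x(t)\|<\varepsilon'$ for all $t>0$; it is asymptotically stable if it is stable and $\|x(t)\|\to0$ as $t\to\infty$ for every $x(0)\in\mathbb R^2$. Norms are Euclidean; $\cosh^{-1}:[1,\infty)\to[0,\infty)$. *)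

(* Defs.v *)
From HB Require Import structures.
From mathcomp Require Import all_boot all_order all_algebra.
From mathcomp Require Import all_classical all_reals all_analysis.
From mathcomp Require Import complex.
From mathcomp Require Import ring lra.

Set Implicit Arguments.
Unset Strict Implicit.
Unset Printing Implicit Defensive.

Import Order.TTheory GRing.Theory Num.Theory.
Import numFieldNormedType.Exports.

Local Open Scope classical_set_scope.
Local Open Scope ring_scope.

Section Hyperbolic.
Context {R : realType}.
Implicit Types x y u v : R.

Definition sinh x : R := (expR x - expR (- x)) / 2.
Definition cosh x : R := (expR x + expR (- x)) / 2.

Definition arsinh x : R := xget 0 [set y | sinh y = x].

(* The inverse of the restriction of cosh to [0, +oo[; it is meant for
   x >= 1, see arcoshP.  In tau_complex below, det M = 1 or -1 and lambda > 0
   make the argument of arcosh at least |det M| = 1. *)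
Definition arcosh x : R := xget 0 [set y | 0 <= y /\ cosh y = x].

Lemma ltr_sinh : {mono sinh : x y / x < y}.
Proof.
apply: leW_mono; apply: le_mono => x y xy; rewrite /sinh.
have : expR x < expR y by rewrite ltr_expR.
have : expR (- y) < expR (- x) by rewrite ltr_expR ltrN2.
by lra.
Qed.

Lemma ler_sinh : {mono sinh : x y / x <= y}.
Proof. by move=> x y; rewrite !leNgt ltr_sinh. Qed.

Lemma sinh_inj : injective sinh.
Proof. by move=> x y e; apply/eqP; rewrite eq_le -[x <= y]ler_sinh -[y <= x]ler_sinh e lexx. Qed.

Lemma sinh0 : sinh 0 = 0.
Proof. by rewrite /sinh oppr0 subrr mul0r. Qed.

Lemma arsinhK : cancel arsinh sinh.
Proof.
move=> x; apply: (@xgetPex _ 0 [set y | sinh y = x]).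
have s2 : Num.sqrt (x ^+ 2 + 1) ^+ 2 = x ^+ 2 + 1.
  by rewrite sqr_sqrtr// addr_ge0// sqr_ge0.
have s0 : 0 <= Num.sqrt (x ^+ 2 + 1) by exact: sqrtr_ge0.
set s := Num.sqrt _ in s2 s0.
have xs : 0 < x + s by nra.
exists (ln (x + s)) => /=; rewrite /sinh expRN lnK ?posrE//.
have -> : (x + s)^-1 = s - x.
  apply: (mulfI (lt0r_neq0 xs)); rewrite divff ?lt0r_neq0//.
  have -> : (x + s) * (s - x) = s ^+ 2 - x ^+ 2 by ring.
  by rewrite s2; ring.
by field.
Qed.

Lemma arcoshP x : 1 <= x -> 0 <= arcosh x /\ cosh (arcosh x) = x.
Proof.
move=> x1; apply: (@xgetPex _ 0 [set y | 0 <= y /\ cosh y = x]).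
have s2 : Num.sqrt (x ^+ 2 - 1) ^+ 2 = x ^+ 2 - 1 by rewrite sqr_sqrtr//; nra.
have s0 : 0 <= Num.sqrt (x ^+ 2 - 1) by exact: sqrtr_ge0.
set s := Num.sqrt _ in s2 s0.
have xs : 0 < x + s by lra.
exists (ln (x + s)) => /=; split; first by apply: ln_ge0; lra.
rewrite /cosh expRN lnK ?posrE//.
have -> : (x + s)^-1 = x - s.
  apply: (mulfI (lt0r_neq0 xs)); rewrite divff ?lt0r_neq0//.
  have -> : (x + s) * (x - s) = x ^+ 2 - s ^+ 2 by ring.
  by rewrite s2; ring.
by field.
Qed.

Lemma sinhB_sinhD u v : sinh (u - v) * sinh (u + v) = sinh u ^+ 2 - sinh v ^+ 2.
Proof.
rewrite /sinh !opprD !opprK !expRD.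
have := expRxMexpNx_1 u; have := expRxMexpNx_1 v.
move: (expR u) (expR (- u)) (expR v) (expR (- v)) => a a' b b' hb ha.
have -> : (a * b' - a' * b) / 2 * ((a * b - a' * b') / 2) =
  (a ^+ 2 * (b * b') - a * a' * (b' ^+ 2 + b ^+ 2) + a' ^+ 2 * (b * b')) / 4.
  by field.
rewrite ha hb.
have -> : ((a - a') / 2) ^+ 2 - ((b - b') / 2) ^+ 2 =
  (a ^+ 2 + a' ^+ 2 - 2 * (a * a') - (b ^+ 2 + b' ^+ 2 - 2 * (b * b'))) / 4.
  by field.
by rewrite ha hb; field.
Qed.

End Hyperbolic.

Section Matrices.
Context {R : realType}.

Definition mx22 (a b c d : R) : 'M[R]_2 :=
  \matrix_(i, j) if i == 0 then (if j == 0 then a else b)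
                 else (if j == 0 then c else d).

Definition complex_eigenvalue (A : 'M[R]_2) (z : R[i]) : bool :=
  eigenvalue (map_mx (real_complex R) A) z.

Definition hurwitz_stable (A : 'M[R]_2) : Prop :=
  forall z, complex_eigenvalue A z -> complex.Re z < 0.

Definition unstable (A : 'M[R]_2) : Prop :=
  exists2 z, complex_eigenvalue A z & 0 < complex.Re z.

(* The library norm on matrices is the maximum norm. *)
Definition enorm n (v : 'cV[R]_n) : R := Num.sqrt (\sum_i v i 0 ^+ 2).

End Matrices.

(* The subsystems A_1, ..., A_N with N = m + 1 are indexed by 'I_m.+1, from 0:
   the internal node A_1 of the star is A ord0, and A_j is A at index j - 1. *)
Section SwitchedSystem.
Context {R : realType} (m : nat).
Implicit Types (A : 'I_m.+1 -> 'M[R]_2) (sigma : R -> 'I_m.+1) (d : nat -> R).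

(* Only the values of sigma on [0, +oo[ matter. *)
Definition switching_times sigma d : Prop :=
  [/\ d 0%N = 0,
      forall i, d i < d i.+1,
      d @ \oo --> +oo,
      forall i t, d i <= t < d i.+1 -> sigma t = sigma (d i)
    & forall i, sigma (d i.+1) <> sigma (d i)].

Definition star_governed sigma d : Prop :=
  forall i, sigma (d (2 * i)%N) = ord0 /\ sigma (d (2 * i).+1) <> ord0.

(* dwell d i is t_(i+1) and flee d i is s_(i+1), with i >= 0. *)
Definition dwell d (i : nat) : R := d (2 * i).+1 - d (2 * i)%N.
Definition flee d (i : nat) : R := d (2 * i).+2 - d (2 * i).+1.

Definition signal_with (tau eta : R) sigma d : Prop :=
  [/\ switching_times sigma d, star_governed sigma d
    & forall i, tau <= dwell d i /\ flee d i <= eta].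

Definition signals (tau eta : R) : set (R -> 'I_m.+1) :=
  [set sigma | exists d, signal_with tau eta sigma d].

Definition signals' (tau eta : R) : set (R -> 'I_m.+1) :=
  [set sigma | exists2 d, signal_with tau eta sigma d
     & ~ ((dwell d i, flee d i) @[i --> \oo] --> (tau, eta))].

(* The equation is required at the positive times around which sigma is
   constant, that is, away from the switching times. *)
Definition solution A sigma (x : R -> 'cV[R]_2) : Prop :=
  {within `[0, +oo[, continuous x} /\
  forall t : R, 0 < t -> (\forall s \near t, sigma s = sigma t) ->
    is_derive t 1 x (A (sigma t) *m x t).

Definition stable A sigma : Prop :=
  forall e : R, 0 < e -> exists2 delta : R, 0 < delta &
    forall x, solution A sigma x -> enorm (x 0) < delta ->
      forall t, 0 < t -> enorm (x t) < e.

Definition asymptotically_stable A sigma : Prop :=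
  stable A sigma /\
  forall x, solution A sigma x -> enorm (x t) @[t --> +oo] --> (0 : R).

End SwitchedSystem.

(* In this section M stands for P_j^-1 P_1 = (a_j b_j; c_j d_j). *)
Section DwellTime.
Context {R : realType}.
Implicit Types (M : 'M[R]_2) (lambda eta : R).

Definition tau_complex (p1 alpha : R) M lambda eta : R :=
  alpha / p1 * eta +
  p1^-1 * arcosh (2^-1 * ((M 0 0 ^+ 2 + M 1 0 ^+ 2) * lambda ^+ 2 +
                          (M 0 1 ^+ 2 + M 1 1 ^+ 2) / lambda ^+ 2)).

Definition tau_jordan (p1 n : R) M lambda eta : R :=
  n / p1 * eta +
  p1^-1 * arsinh (2^-1 * (M 1 0 ^+ 2 * lambda ^+ 2 +
                          M 1 1 ^+ 2 / lambda ^+ 2) * eta).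

Definition tau_diag_eq (p1 p q : R) M lambda eta (tau : R) : Prop :=
  q / p1 * eta <= tau /\
  sinh (p1 * tau - q * eta) * sinh (p1 * tau - p * eta) =
  (M 0 1 * M 1 1 / lambda ^+ 2 + M 0 0 * M 1 0 * lambda ^+ 2) ^+ 2 *
  sinh ((q - p) / 2 * eta) ^+ 2.

(* The unique such tau, see tau_diag_unique. *)
Definition tau_diag (p1 p q : R) M lambda eta : R :=
  xget 0 [set tau | tau_diag_eq p1 p q M lambda eta tau].

Lemma tau_diag_unique (p1 p q : R) M lambda eta :
  0 < p1 -> p <= q -> 0 < eta ->
  exists! tau, tau_diag_eq p1 p q M lambda eta tau.
Proof.
move=> p1_gt0 pq eta_gt0; rewrite /tau_diag_eq.
set C := _ / _ + _; set v := (q - p) / 2 * eta; set w := (p + q) / 2 * eta.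
have v0 : 0 <= v by rewrite /v; nra.
have sv0 : 0 <= sinh v by rewrite -sinh0 ler_sinh.
have E tau : sinh (p1 * tau - q * eta) * sinh (p1 * tau - p * eta) =
    sinh (p1 * tau - w) ^+ 2 - sinh v ^+ 2.
  by rewrite -sinhB_sinhD; congr (sinh _ * sinh _); rewrite /w /v; field.
have L tau : (q / p1 * eta <= tau) = (v <= p1 * tau - w).
  rewrite (_ : q / p1 * eta = (w + v) / p1); last by rewrite /w /v; field; lra.
  by rewrite ler_pdivrMr// [tau * _]mulrC lerBrDl.
pose S := Num.sqrt (1 + C ^+ 2) * sinh v.
have S2 : S ^+ 2 = (1 + C ^+ 2) * sinh v ^+ 2.
  by rewrite exprMn sqr_sqrtr// addr_ge0// sqr_ge0.
have S0 : 0 <= S by rewrite mulr_ge0// sqrtr_ge0.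
have vS : sinh v <= S.
  by rewrite -(@ler_pXn2r _ 2)// ?nnegrE// S2; have := sqr_ge0 (C * sinh v); nra.
have K : p1 * ((arsinh S + w) / p1) - w = arsinh S by field; lra.
exists ((arsinh S + w) / p1); split=> [|tau []].
  by rewrite L E K arsinhK S2 -ler_sinh arsinhK; split=> //; ring.
rewrite L E -ler_sinh => vt e.
have : sinh (p1 * tau - w) ^+ 2 = S ^+ 2 by rewrite S2; lra.
move/eqP; rewrite eqrXn2// ?(le_trans sv0 vt)// => /eqP {}e.
have : arsinh S = p1 * tau - w by apply: sinh_inj; rewrite arsinhK e.
by move=> ->; field; lra.
Qed.

Context (m : nat).

Definition tau12 (k l : nat) (p q alpha n : 'I_m.+1 -> R)
    (P : 'I_m.+1 -> 'M[R]_2) (j : 'I_m.+1) lambda eta : R :=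
  let M := invmx (P j) *m P ord0 in
  if (j <= k)%N then tau_complex (p ord0) (alpha j) M lambda eta
  else if (j <= k + l)%N then tau_jordan (p ord0) (n j) M lambda eta
  else tau_diag (p ord0) (p j) (q j) M lambda eta.

(* The neutral element 0 is harmless for a nonempty star: tau12 is nonnegative
   when alpha_j, n_j, q_j >= 0, and q_j > 0 for an unstable diagonal block. *)
Definition max_leaves (F : 'I_m.+1 -> R) : R :=
  \big[Num.max/0]_(j | j != ord0) F j.

Definition inf_or_eps (eps : R) (f : R -> R) : R :=
  let f_inf := inf [set f lambda | lambda in [set lambda | 0 < lambda]] in
  if `[< exists2 lambda, 0 < lambda & f lambda = f_inf >] then f_inf
  else f_inf + eps.

End DwellTime.

(* Main.v *)
Require Import Defs.
From HB Require Import structures.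
From mathcomp Require Import all_boot all_order all_algebra.
From mathcomp Require Import all_classical all_reals all_analysis.
From mathcomp Require Import complex ring lra.

(** The idea is to find one Euclidean norm in which every passage through a leaf
    is compensated by the preceding stay in the node.

    Let lambda > 0 and S = diag(lambda, 1/lambda).  In the coordinates
    y = (P_1 S)^-1 x the node is still diagonal, because S is, and a stay of
    length t contracts the Euclidean norm of y by exp (- p_1 t), see
    [node_flow_le].  In the same coordinates a stay of length s in leaf j acts
    by L^-1 exp (s J_j) L with L = P_j^-1 P_1 S, where det L = 1 or -1.  The
    squared singular values of a planar matrix of determinant 1 or -1 have
    product 1 and sum the squared Frobenius norm, so that its operator norm is
    explicit ([enorm_mul_le]): for a spiral one bounds the operator norm by the
    condition number of L, for a Jordan or a diagonal block one computes the
    Frobenius norm of the conjugated exponential.  The dwell time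
    tau_j(lambda, eta) is exactly the number for which the resulting bound at
    s = eta is exp (p_1 tau_j).  For s <= eta the bound is better by the factor
    exp (- g_j (eta - s)), where g_j > 0 is the largest real part of an
    eigenvalue of J_j ([leaf_flow_le], [leaf_rate_gt0]).

    By [inf_or_eps_ge] some lambda has max_j tau_j(lambda, eta) <= tau(eta).
    With g = min(1, g_2, ..., g_N), the k-th cycle then multiplies the norm of y
    by at most exp (- p_1 (t_k - tau) - g (eta - s_k)) <= 1, whence stability.
    If (t_k, s_k) does not converge to (tau, eta), the nonnegative numbers
    (t_k - tau) + (eta - s_k) do not tend to 0, so their sum diverges and the
    norm tends to 0 ([cycles_vanish]).

    The flows themselves come from scalar equations f' = c f, to which each
    subsystem reduces in its normal coordinates ([exp_growth]). *)

Set Implicit Arguments.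
Unset Strict Implicit.
Unset Printing Implicit Defensive.

Import Order.TTheory GRing.Theory Num.Theory.
Import numFieldNormedType.Exports.

Local Open Scope classical_set_scope.
Local Open Scope ring_scope.

(** * Hyperbolic functions *)

Section HyperbolicIdentities.
Context {R : realType}.
Implicit Types u v r K : R.

Lemma coshM2 u : cosh (2 * u) = 1 + 2 * sinh u ^+ 2.
Proof.
rewrite /cosh /sinh -mulrN !expRM_natl.
have := expRxMexpNx_1 u; move: (expR u) (expR (- u)) => a b ab.
have -> : 1 + 2 * ((a - b) / 2) ^+ 2 = 1 + (a ^+ 2 + b ^+ 2 - 2 * (a * b)) / 2.
  by field.
by rewrite ab; field.
Qed.

Lemma cosh_sqr u : cosh u ^+ 2 = 1 + sinh u ^+ 2.
Proof.
rewrite /cosh /sinh.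
have := expRxMexpNx_1 u; move: (expR u) (expR (- u)) => a b ab.
have -> : ((a + b) / 2) ^+ 2 = a * b + ((a - b) / 2) ^+ 2 by field.
by rewrite ab.
Qed.

Lemma cosh_gt0 u : 0 < cosh u.
Proof. by rewrite /cosh divr_gt0// addr_gt0// expR_gt0. Qed.

Lemma sinhB u v : sinh (u - v) = sinh u * cosh v - cosh u * sinh v.
Proof. by rewrite /sinh /cosh opprB addrC !expRD; field. Qed.

Lemma sinh_ge0 u : 0 <= u -> 0 <= sinh u.
Proof. by rewrite -{2}sinh0 ler_sinh. Qed.

Lemma arsinh_ge0 u : 0 <= u -> 0 <= arsinh u.
Proof. by move=> u0; rewrite -ler_sinh arsinhK sinh0. Qed.

(** Decreasing v by d decreases r = arsinh (sqrt K * sinh v) by at least d: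
    for K >= 1 this r has derivative at least 1 in v.  The proof replaces the
    derivative by the addition formula for sinh, where the claim reduces to
    cosh r <= sqrt K * cosh v.  It is the reason why, in a diagonal leaf, the
    worst time is the largest one even when p + q < 0. *)
Lemma sinh_sqr_sub K v r d : 1 <= K -> 0 <= v -> 0 <= r ->
  sinh r ^+ 2 = K * sinh v ^+ 2 -> 0 <= d <= v ->
  K * sinh (v - d) ^+ 2 <= sinh (r - d) ^+ 2.
Proof.
move=> K1 v0 r0 rv /andP[d0 dv].
have [sv0 sr0 sd0] : [/\ 0 <= sinh v, 0 <= sinh r & 0 <= sinh d].
  by split; apply: sinh_ge0.
pose k := Num.sqrt K.
have k2 : k ^+ 2 = K by rewrite sqr_sqrtr//; lra.
have k0 : 0 <= k by rewrite sqrtr_ge0.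
have k1 : 1 <= k by rewrite -[1]sqrtr1 ler_sqrt//; lra.
have ksv0 : 0 <= k * sinh v by exact: mulr_ge0.
have srE : sinh r = k * sinh v.
  by apply/eqP; rewrite -(eqrXn2 (n := 2))// (exprMn 2 k) k2 rv.
have vr : v <= r by rewrite -ler_sinh srE ler_peMl.
have crE : cosh r <= k * cosh v.
  have [cr0 cv0] := (cosh_gt0 r, cosh_gt0 v).
  have kcv0 : 0 <= k * cosh v by apply: mulr_ge0 => //; exact: ltW.
  by rewrite -(ler_pXn2r (n := 2))// ?nnegrE ?(ltW cr0)//;
    rewrite (exprMn 2 k) k2 !cosh_sqr rv; lra.
have svd0 : 0 <= sinh (v - d) by apply: sinh_ge0; lra.
have srd0 : 0 <= sinh (r - d) by apply: sinh_ge0; lra.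
have ksvd0 : 0 <= k * sinh (v - d) by exact: mulr_ge0.
rewrite -k2 -(exprMn 2 k) ler_pXn2r//.
rewrite !sinhB srE -subr_ge0 (_ : _ - _ = sinh d * (k * cosh v - cosh r)).
  by rewrite mulr_ge0// subr_ge0.
by ring.
Qed.

End HyperbolicIdentities.

(** * Euclidean norm and determinant of planar matrices *)

Section PlanarMatrices.
Context {R : realType}.
Implicit Types (A B L : 'M[R]_2) (v y : 'cV[R]_2) (r s : R).

Lemma sum_ord2 (V : nmodType) (F : 'I_2 -> V) : \sum_i F i = F 0 + F 1.
Proof.
by rewrite 2!big_ord_recl big_ord0 addr0; congr (_ + F _); apply/val_inj.
Qed.

Lemma mulmx22E A v i : (A *m v) i 0 = A i 0 * v 0 0 + A i 1 * v 1 0.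
Proof. by rewrite mxE sum_ord2. Qed.

Lemma ord2P (Q : 'I_2 -> Prop) : Q 0 -> Q 1 -> forall i, Q i.
Proof.
move=> Q0 Q1 [[|[|//]] h];
  [rewrite (_ : Ordinal _ = 0)|rewrite (_ : Ordinal _ = 1)] => //;
  exact/val_inj.
Qed.

Lemma det22 (K : comPzRingType) (A : 'M[K]_2) :
  \det A = A 0 0 * A 1 1 - A 0 1 * A 1 0.
Proof.
rewrite (expand_det_row _ 0) sum_ord2 /cofactor !det_mx11 !mxE.
have [-> ->] : lift 0 0 = 1 :> 'I_2 /\ lift 1 0 = 0 :> 'I_2.
  by split; exact/val_inj.
by rewrite /= expr0 expr1; ring.
Qed.

Lemma enormE v : enorm v ^+ 2 = v 0 0 ^+ 2 + v 1 0 ^+ 2.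
Proof. by rewrite /enorm sum_ord2 sqr_sqrtr// addr_ge0// sqr_ge0. Qed.

Lemma enorm_ge0 n (v : 'cV[R]_n) : 0 <= enorm v.
Proof. exact: sqrtr_ge0. Qed.

Lemma enormZ r v : 0 <= r -> enorm (r *: v) = r * enorm v.
Proof.
move=> r0; apply/eqP; rewrite -(@eqrXn2 _ 2)// ?mulr_ge0// ?enorm_ge0//.
by rewrite exprMn !enormE !mxE; apply/eqP; ring.
Qed.

Definition fnorm2 A : R := A 0 0 ^+ 2 + A 0 1 ^+ 2 + A 1 0 ^+ 2 + A 1 1 ^+ 2.

Lemma enorm_mul_bounded A : exists2 C, 0 < C &
  forall v, enorm (A *m v) <= C * enorm v.
Proof.
have F0 : 0 <= fnorm2 A by rewrite /fnorm2 !addr_ge0// sqr_ge0.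
have S2 : Num.sqrt (fnorm2 A + 1) ^+ 2 = fnorm2 A + 1.
  by rewrite sqr_sqrtr//; lra.
(* The summand 1 makes the constant positive also for A = 0. *)
exists (Num.sqrt (fnorm2 A + 1)); first by rewrite sqrtr_gt0; lra.
move=> v; rewrite -(@ler_pXn2r _ 2)// ?nnegrE ?mulr_ge0 ?sqrtr_ge0 ?enorm_ge0//.
rewrite exprMn S2 !enormE !mulmx22E /fnorm2.
move: (A 0 0) (A 0 1) (A 1 0) (A 1 1) (v 0 0) (v 1 0) => a b c d x y.
rewrite -subr_ge0 (_ : _ - _ =
  (a * y - b * x) ^+ 2 + (c * y - d * x) ^+ 2 + x ^+ 2 + y ^+ 2); last by ring.
by rewrite !addr_ge0// sqr_ge0.
Qed.

(** The two conditions make both diagonal coefficients nonnegative; for a > 0,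
    completing the square turns a times the form into a sum of squares. *)
Lemma quad_form_ge0 (a b c x y : R) : 0 <= a + c -> b ^+ 2 <= a * c ->
  0 <= a * x ^+ 2 + 2 * b * (x * y) + c * y ^+ 2.
Proof.
move=> ac0 bac.
have a0 : 0 <= a by rewrite leNgt; apply/negP => a0; nra.
have c0 : 0 <= c by rewrite leNgt; apply/negP => c0; nra.
have [aE|an0] := eqVneq a 0.
  have -> : b = 0.
    by apply/eqP; rewrite -sqrf_eq0 eq_le sqr_ge0 andbT -(mul0r c) -aE.
  by rewrite aE mulr0 !mul0r !add0r mulr_ge0// sqr_ge0.
have a_gt0 : 0 < a by rewrite lt_neqAle eq_sym an0.
rewrite -(pmulr_rge0 _ a_gt0).
have -> : a * (a * x ^+ 2 + 2 * b * (x * y) + c * y ^+ 2) =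
  (a * x + b * y) ^+ 2 + (a * c - b ^+ 2) * y ^+ 2 by ring.
by rewrite addr_ge0 ?sqr_ge0// mulr_ge0 ?sqr_ge0// subr_ge0.
Qed.

(** The singular values s1 >= s2 of B satisfy s1 * s2 = 1 and
    s1^2 + s2^2 = fnorm2 B, so that s1 = exp r, with r >= 0, if and only if
    fnorm2 B = 2 cosh (2 r).  The proof shows that
    exp (2 r) - B^T B is positive semidefinite through its trace and its
    determinant. *)
Lemma enorm_mul_le B r v : 0 <= r -> \det B ^+ 2 = 1 ->
  fnorm2 B <= 2 * cosh (2 * r) -> enorm (B *m v) <= expR r * enorm v.
Proof.
move=> r0 dB FB.
rewrite -(@ler_pXn2r _ 2)// ?nnegrE ?mulr_ge0 ?expR_ge0 ?enorm_ge0//.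
rewrite exprMn !enormE !mulmx22E -expRM_natl.
move: dB FB; rewrite det22 /fnorm2 /cosh.
have rE : expR (- (2 * r)) <= expR (2 * r) by rewrite ler_expR; lra.
have := expRxMexpNx_1 (2 * r); have := expR_gt0 (2 * r).
move: (expR (2 * r)) (expR (- (2 * r))) rE => e f fe e0 ef.
move: (B 0 0) (B 0 1) (B 1 0) (B 1 1) (v 0 0) (v 1 0) => a b c d x y dB FB.
rewrite -subr_ge0 (_ : _ - _ = (e - (a ^+ 2 + c ^+ 2)) * x ^+ 2 +
   2 * - (a * b + c * d) * (x * y) + (e - (b ^+ 2 + d ^+ 2)) * y ^+ 2);
   last by ring.
apply: quad_form_ge0; first by lra.
rewrite -subr_ge0 (_ : _ - _ = e ^+ 2 - e * (a ^+ 2 + b ^+ 2 + c ^+ 2 + d ^+ 2)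
   + (a * d - b * c) ^+ 2); last by ring.
have : 0 <= e * (e + f - (a ^+ 2 + b ^+ 2 + c ^+ 2 + d ^+ 2)).
  by apply: mulr_ge0; lra.
by rewrite dB -ef; lra.
Qed.

Lemma invmx22 L : \det L ^+ 2 = 1 ->
  invmx L = \det L *: mx22 (L 1 1) (- L 0 1) (- L 1 0) (L 0 0).
Proof.
move=> dL; have Lu : L \in unitmx.
  by rewrite unitmxE unitfE -sqrf_eq0 dL oner_neq0.
suff : (\det L *: mx22 (L 1 1) (- L 0 1) (- L 1 0) (L 0 0)) *m L = 1%:M.
  by move/(congr1 (mulmx^~ (invmx L))); rewrite /= mulmxK// mul1mx.
apply/matrixP; move: dL; rewrite det22 => dL.
by apply: ord2P; apply: ord2P; rewrite !mxE sum_ord2 !mxE/= -?dL; ring.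
Qed.

Lemma det_invmx_sqr L : \det L ^+ 2 = 1 -> \det (invmx L) ^+ 2 = 1.
Proof. by move=> dL; rewrite det_inv exprVn dL invr1. Qed.

Lemma fnorm2_invmx L : \det L ^+ 2 = 1 -> fnorm2 (invmx L) = fnorm2 L.
Proof.
move=> dL; rewrite invmx22// /fnorm2 !mxE/= !exprMn dL; ring.
Qed.

End PlanarMatrices.

(** * Norms of conjugated matrix exponentials *)

Section ConjugatedFlows.
Context {R : realType}.
Implicit Types (L : 'M[R]_2) (y z : 'cV[R]_2).

(** These are the exponentials of s times the diagonal block diag(p, q) and of
    s times the Jordan block with eigenvalue n. *)
Definition diag_flow (p q s : R) : 'M[R]_2 :=
  mx22 (expR (p * s)) 0 0 (expR (q * s)).

Definition jordan_flow (n s : R) : 'M[R]_2 := expR (n * s) *: mx22 1 s 0 1.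

Lemma det_conj L A : \det L ^+ 2 = 1 -> \det (invmx L *m A *m L) = \det A.
Proof.
move=> dL; rewrite !det_mulmx det_inv mulrAC mulVr ?mul1r//.
by rewrite unitfE -sqrf_eq0 dL oner_neq0.
Qed.

Lemma fnorm2_conj_diag L v : \det L ^+ 2 = 1 ->
  fnorm2 (invmx L *m diag_flow (-1) 1 v *m L) =
  2 + 4 * ((1 + (L 0 0 * L 1 0 + L 0 1 * L 1 1) ^+ 2) * sinh v ^+ 2).
Proof.
move=> dL; rewrite invmx22// /fnorm2 !(mxE, sum_ord2)/= /sinh mulN1r mul1r.
have := expRxMexpNx_1 v; move: (expR v) (expR (- v)) => e f ef.
move: dL; rewrite det22.
move: (L 0 0) (L 0 1) (L 1 0) (L 1 1) => a b c d dL.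
pose D := a * d - b * c.
(* An identity of polynomials holds before D ^+ 2 is replaced by 1. *)
transitivity (D ^+ 2 * (D ^+ 2 * (e ^+ 2 + f ^+ 2) +
                        (a * c + b * d) ^+ 2 * (e - f) ^+ 2)).
  by rewrite /D; ring.
rewrite /D dL; have -> : e ^+ 2 + f ^+ 2 = (e - f) ^+ 2 + 2 * (e * f) by ring.
by rewrite ef; field.
Qed.

(** Up to the scalar exp ((p + q) s / 2) the flow is a matrix of determinant 1,
    whose norm exp (rho s) is given by [fnorm2_conj_diag], with rho eta = r.
    From eta to s, the first exponent drops by (p + q) (eta - s) / 2 and, by
    [sinh_sqr_sub], rho by at least (q - p) (eta - s) / 2: the sum of both is
    q (eta - s). *)
Lemma conj_diag_flow_le L (p q s eta r : R) y : \det L ^+ 2 = 1 ->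
  p <= q -> 0 <= s <= eta -> (q - p) / 2 * eta <= r ->
  sinh r ^+ 2 = (1 + (L 0 0 * L 1 0 + L 0 1 * L 1 1) ^+ 2) *
                sinh ((q - p) / 2 * eta) ^+ 2 ->
  enorm (invmx L *m (diag_flow p q s *m (L *m y))) <=
  expR ((p + q) / 2 * eta + r - q * (eta - s)) * enorm y.
Proof.
move=> dL pq /andP[s0 seta] vr rE.
pose v := (q - p) / 2 * s; pose delta := (q - p) / 2 * (eta - s).
have v0 : 0 <= v by rewrite /v mulr_ge0//; lra.
have d0 : 0 <= delta by rewrite /delta mulr_ge0//; lra.
have vD : (q - p) / 2 * eta = v + delta by rewrite /v /delta; ring.
have -> : diag_flow p q s = expR ((p + q) / 2 * s) *: diag_flow (-1) 1 v.
  apply/matrixP; apply: ord2P; apply: ord2P;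
    by rewrite !mxE/= ?mulr0// -expRD; congr expR; rewrite /v; field.
rewrite -scalemxAl -scalemxAr enormZ ?expR_ge0//.
have -> : (p + q) / 2 * eta + r - q * (eta - s) =
    (p + q) / 2 * s + (r - delta) by rewrite /delta; field.
rewrite expRD -[leRHS]mulrA ler_wpM2l ?expR_ge0// !mulmxA.
apply: enorm_mul_le; first by lra.
- by rewrite det_conj// det22 !mxE/= -expRD mulN1r mul1r addNr expR0; ring.
- rewrite fnorm2_conj_diag// coshM2.
  have := @sinh_sqr_sub R (1 + (L 0 0 * L 1 0 + L 0 1 * L 1 1) ^+ 2)
    (v + delta) r delta.
  rewrite addrK -vD lerDl sqr_ge0 rE => /(_ isT).
  have -> : 0 <= (q - p) / 2 * eta by lra.
  have -> : 0 <= r by lra.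
  have -> : 0 <= delta <= (q - p) / 2 * eta by rewrite d0; lra.
  by move=> /(_ isT isT erefl isT); lra.
Qed.

Lemma fnorm2_conj_jordan L s : \det L ^+ 2 = 1 ->
  fnorm2 (invmx L *m mx22 1 s 0 1 *m L) =
  2 + ((L 1 0 ^+ 2 + L 1 1 ^+ 2) * s) ^+ 2.
Proof.
move=> dL; rewrite invmx22// /fnorm2 !(mxE, sum_ord2)/=.
move: dL; rewrite det22.
move: (L 0 0) (L 0 1) (L 1 0) (L 1 1) => a b c d dL.
pose D := a * d - b * c.
transitivity (D ^+ 2 * (2 * D ^+ 2 + ((c ^+ 2 + d ^+ 2) * s) ^+ 2)).
  by rewrite /D; ring.
by rewrite /D dL; ring.
Qed.

Lemma conj_jordan_flow_le L (n s eta : R) y : \det L ^+ 2 = 1 ->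
  0 <= s <= eta ->
  enorm (invmx L *m (jordan_flow n s *m (L *m y))) <=
  expR (n * s + arsinh (2^-1 * (L 1 0 ^+ 2 + L 1 1 ^+ 2) * eta)) * enorm y.
Proof.
move=> dL /andP[s0 seta].
have G0 : 0 <= L 1 0 ^+ 2 + L 1 1 ^+ 2 by rewrite addr_ge0 ?sqr_ge0.
rewrite -scalemxAl -scalemxAr enormZ ?expR_ge0// expRD -[leRHS]mulrA.
rewrite ler_wpM2l ?expR_ge0// !mulmxA.
apply: enorm_mul_le.
- by rewrite arsinh_ge0// !mulr_ge0//; lra.
- by rewrite det_conj// det22 !mxE/=; ring.
- rewrite fnorm2_conj_jordan// coshM2 arsinhK.
  move: (_ + _) G0 => G G0; have : (G * s) ^+ 2 <= (G * eta) ^+ 2.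
    have Gs : 0 <= G * s by exact: mulr_ge0.
    have Ge : G * s <= G * eta by exact: ler_wpM2l.
    by rewrite ler_pXn2r// nnegrE (le_trans Gs).
  have -> : (2^-1 * G * eta) ^+ 2 = (G * eta) ^+ 2 / 4 by field.
  by lra.
Qed.

Lemma fnorm2_ge2 L : \det L ^+ 2 = 1 -> 2 <= fnorm2 L.
Proof.
rewrite det22 /fnorm2; move: (L 0 0) (L 0 1) (L 1 0) (L 1 1) => a b c d dL.
have [D|D] : a * d - b * c = 1 \/ a * d - b * c = -1.
- by move/eqP: dL; rewrite sqrf_eq1 => /orP[] /eqP; [left|right].
- by have := sqr_ge0 (a - d); have := sqr_ge0 (b + c); nra.
- by have := sqr_ge0 (a + d); have := sqr_ge0 (b - c); nra.
Qed.

(** This serves a spiral, whose flow is exp rho times a rotation: only the norm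
    of z is known, and the bound is the condition number of L, which is the
    square of its norm because L and its inverse have the same norm. *)
Lemma conj_similarity_le L (rho : R) y z : \det L ^+ 2 = 1 ->
  enorm z = expR rho * enorm (L *m y) ->
  enorm (invmx L *m z) <= expR (rho + arcosh (2^-1 * fnorm2 L)) * enorm y.
Proof.
move=> dL zE; set kappa := arcosh _.
have [k0 kE] : 0 <= kappa /\ cosh kappa = 2^-1 * fnorm2 L.
  by apply: arcoshP; have := fnorm2_ge2 dL; lra.
have F : fnorm2 L <= 2 * cosh (2 * (kappa / 2)).
  by rewrite (_ : 2 * (kappa / 2) = kappa) ?kE; [lra|field].
have k20 : 0 <= kappa / 2 by rewrite divr_ge0.
have h1 : enorm (invmx L *m z) <= expR (kappa / 2) * enorm z.
  by apply: enorm_mul_le; rewrite ?det_invmx_sqr ?fnorm2_invmx.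
have h2 : enorm (L *m y) <= expR (kappa / 2) * enorm y by exact: enorm_mul_le.
apply: le_trans h1 _; rewrite zE.
rewrite (_ : rho + kappa = kappa / 2 + (rho + kappa / 2)); last by field.
by rewrite !expRD -!mulrA !ler_wpM2l ?expR_ge0.
Qed.

End ConjugatedFlows.

(** * Planar linear differential equations *)

Section LinearFlows.
Context {R : realType}.
Implicit Types (A B J P : 'M[R]_2) (x z : R -> 'cV[R]_2) (a b c s t : R).

(** The function exp (- c (t - a)) * f t has zero derivative, hence is constant
    by the mean value theorem. *)
Lemma exp_growth c (f : R -> R) a b : a <= b ->
  {within `[a, b], continuous f} ->
  (forall t, a < t < b -> is_derive t 1 f (c * f t)) ->
  f b = expR (c * (b - a)) * f a.
Proof.
move=> ab fc fd; have [<-|aNb] := eqVneq a b.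
  by rewrite subrr mulr0 expR0 mul1r.
have {aNb}ab : a < b by rewrite lt_neqAle aNb.
pose h t := expR (- c * (t - a)).
have hd t : is_derive t 1 h (- c * h t).
  rewrite mulrC; apply: (@is_derive1_comp _ expR (fun t => - c * (t - a))).
  by apply: is_derive_eq; rewrite subr0 /GRing.scale/= mulr1.
have hc : continuous h.
  by move=> t; apply: differentiable_continuous; apply/derivable1_diffP.
have [||t _] := @MVT R (fun t => h t * f t) (fun=> 0) a b ab.
- move=> t; rewrite in_itv/= => /fd tab.
  by apply: is_derive_eq; rewrite /GRing.scale/=; ring.
- move=> t; apply: cvgM; last exact: fc.
  exact: (continuous_subspaceT hc).
rewrite mul0r /h subrr mulr0 expR0 mul1r => /eqP.
rewrite subr_eq0 => /eqP <-.
by rewrite mulrA -expRD mulNr subrr expR0 mul1r.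
Qed.

(** The equation is written coordinatewise, so that it can be solved through
    scalar functions only. *)
Definition flows_on J z a b : Prop := forall i,
  {within `[a, b], continuous (fun t => z t i 0)} /\
  forall t, a < t < b -> is_derive t 1 (fun s => z s i 0) ((J *m z t) i 0).

Lemma flows_onW J z a b c : c <= b -> flows_on J z a b -> flows_on J z a c.
Proof.
move=> cb zJ i; have [zc zd] := zJ i; split.
  apply: continuous_subspaceW zc => t /=; rewrite !in_itv/= => /andP[-> tc].
  exact: le_trans cb.
by move=> t /andP[at_ tc]; apply: zd; rewrite at_ (lt_le_trans tc).
Qed.

Lemma flows_on_mulmx B A J x a b : B *m A = J *m B ->
  flows_on A x a b -> flows_on J (fun t => B *m x t) a b.
Proof.
move=> BA xA i.
have [[xc0 xd0] [xc1 xd1]] := (xA 0, xA 1).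
have -> : (fun t => (B *m x t) i 0) =
    (fun t => B i 0 * x t 0 0 + B i 1 * x t 1 0).
  by apply/funext => t; rewrite mulmx22E.
split=> [t|t tab].
  by apply: cvgD; apply: cvgM;
    [exact: cvg_cst|exact: xc0|exact: cvg_cst|exact: xc1].
have := xd0 t tab; have := xd1 t tab => d1 d0.
rewrite mulmxA -BA -mulmxA mulmx22E.
by apply: is_derive_eq; rewrite /GRing.scale/=.
Qed.

Lemma diag_flowE p q z a b : a <= b -> flows_on (mx22 p 0 0 q) z a b ->
  z b = diag_flow p q (b - a) *m z a.
Proof.
move=> ab zJ; apply/matrixP => i j; rewrite ord1 {j} mulmx22E.
have [[c0 d0] [c1 d1]] := (zJ 0, zJ 1).
move: i; apply: ord2P; rewrite !mxE/= ?mul0r ?addr0 ?add0r.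
- apply: (exp_growth (f := fun t => z t 0 0)) => // t /d0.
  by rewrite mulmx22E !mxE/= mul0r addr0.
- apply: (exp_growth (f := fun t => z t 1 0)) => // t /d1.
  by rewrite mulmx22E !mxE/= mul0r add0r.
Qed.

(** Besides the second coordinate, z_0 - (t - a) z_1 satisfies the scalar
    equation f' = n f. *)
Lemma jordan_flowE n z a b : a <= b -> flows_on (mx22 n 1 0 n) z a b ->
  z b = jordan_flow n (b - a) *m z a.
Proof.
move=> ab zJ.
have [[c0 d0] [c1 d1]] := (zJ 0, zJ 1).
have z1E : z b 1 0 = expR (n * (b - a)) * z a 1 0.
  apply: (exp_growth (f := fun t => z t 1 0)) => // t /d1.
  by rewrite mulmx22E !mxE/= mul0r add0r.
have hc : continuous (fun s => s - a).
  by move=> s; apply: cvgB; [exact: cvg_id|exact: cvg_cst].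
have : z b 0 0 - (b - a) * z b 1 0 =
    expR (n * (b - a)) * (z a 0 0 - (a - a) * z a 1 0).
  apply: (exp_growth (f := fun t => z t 0 0 - (t - a) * z t 1 0)) => //.
    move=> t; apply: cvgB; first exact: c0.
    apply: cvgM; last exact: c1.
    exact: (continuous_subspaceT hc).
  move=> t tab; have := d0 t tab; have := d1 t tab.
  rewrite !mulmx22E !mxE/= mul0r add0r => e1 e0.
  by apply: is_derive_eq; rewrite /GRing.scale/=; ring.
rewrite subrr mul0r subr0 => z0E.
apply/matrixP => i j; rewrite ord1 {j} mulmx22E.
move: i; apply: ord2P; rewrite !mxE/=.
- have -> : z b 0 0 = z b 0 0 - (b - a) * z b 1 0 + (b - a) * z b 1 0 by ring.
  by rewrite z0E z1E; ring.
- by rewrite z1E; ring.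
Qed.

(** The flow is exp (alpha t) times a rotation; accordingly, the squared norm
    satisfies the scalar equation f' = 2 alpha f. *)
Lemma spiral_flowE alpha beta z a b : a <= b ->
  flows_on (mx22 alpha beta (- beta) alpha) z a b ->
  enorm (z b) = expR (alpha * (b - a)) * enorm (z a).
Proof.
move=> ab zJ; apply/eqP.
rewrite -(eqrXn2 (n := 2)) ?mulr_ge0 ?expR_ge0 ?enorm_ge0//; apply/eqP.
rewrite exprMn !enormE -expRM_natl mulrA.
have [[c0 d0] [c1 d1]] := (zJ 0, zJ 1).
apply: (exp_growth (f := fun t => z t 0 0 ^+ 2 + z t 1 0 ^+ 2)) => //.
  by move=> t; apply: cvgD; apply: cvgM; by [exact: c0|exact: c1].
move=> t tab; have := d0 t tab; have := d1 t tab.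
rewrite !mulmx22E !mxE/= => e1 e0.
by apply: is_derive_eq; rewrite /GRing.scale/=; ring.
Qed.

Lemma is_derive_coord x t v i : is_derive t 1 x v ->
  is_derive t 1 (fun s => x s i 0) (v i 0).
Proof.
move=> [xd <-]; rewrite derive_mx// mxE; apply/derivableP.
exact: (derivable_mxP _ _ _).1 xd i 0.
Qed.

End LinearFlows.

(** * Spectra of the unstable blocks *)

Section UnstableBlocks.
Context {R : realType}.
Implicit Types (J P : 'M[R]_2).

Lemma eigenvalue_det (F : fieldType) n (A : 'M[F]_n) z :
  eigenvalue A z = (\det (A - z%:M) == 0).
Proof.
by rewrite /eigenvalue /eigenspace kermx_eq0 row_free_unit unitmxE unitfE negbK.
Qed.

Lemma complex_eigenvalue_conj P J z : P \in unitmx ->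
  complex_eigenvalue (P *m J *m invmx P) z = complex_eigenvalue J z.
Proof.
move=> Pu; rewrite /complex_eigenvalue !eigenvalue_det !map_mxM map_invmx.
set Pc := map_mx _ P; set Jc := map_mx _ J.
have Pcu : Pc \in unitmx by rewrite map_unitmx.
have -> : Pc *m Jc *m invmx Pc - z%:M = Pc *m (Jc - z%:M) *m invmx Pc.
  by rewrite mulmxBr mulmxBl scalar_mxC mulmxK.
by rewrite !det_mulmx det_inv mulrAC divff ?mul1r//.
Qed.

Lemma complex_eigenvalue22 J z : complex_eigenvalue J z ->
  (real_complex R (J 0 0) - z) * (real_complex R (J 1 1) - z) =
  real_complex R (J 0 1 * J 1 0).
Proof.
rewrite /complex_eigenvalue eigenvalue_det det22 !mxE/= !mulr1n !mulr0n !subr0.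
by rewrite subr_eq0 => /eqP ->; rewrite rmorphM.
Qed.

Lemma unstable_conj P J : P \in unitmx ->
  unstable (P *m J *m invmx P) -> unstable J.
Proof. by move=> Pu [z]; rewrite complex_eigenvalue_conj//; exists z. Qed.

Lemma unstable_upper a b d :
  unstable (mx22 a b 0 d : 'M[R]_2) -> 0 < a \/ 0 < d.
Proof.
case=> z /complex_eigenvalue22; rewrite !mxE/= mulr0 rmorph0 => /eqP.
by rewrite mulf_eq0 !subr_eq0 => /orP[] /eqP <- /=; [left|right].
Qed.

Lemma unstable_spiral alpha beta :
  unstable (mx22 alpha beta (- beta) alpha : 'M[R]_2) -> beta != 0 -> 0 < alpha.
Proof.
case=> -[x y] /complex_eigenvalue22; rewrite !mxE/= => e x0 b0.
move: e => /eqP; rewrite eq_complex/= => /andP[/eqP e1 /eqP e2].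
have b2 : 0 < beta ^+ 2 by rewrite lt_neqAle eq_sym sqrf_eq0 b0 sqr_ge0.
have y0 : y != 0 by apply/eqP => y0; subst y; have := sqr_ge0 (alpha - x); nra.
suff -> : alpha = x by [].
by apply: (mulIf y0); lra.
Qed.

End UnstableBlocks.

(** * Growth along one subsystem *)

Section LeafGrowth.
Context {R : realType}.
Implicit Types (M P J L : 'M[R]_2) (x y z : R -> 'cV[R]_2).

(** This matrix commutes with the diagonal block of the node: replacing P_1 by
    P_1 * scaling lambda keeps the diagonalization of A_1 and only changes the
    Euclidean norm used to measure the growth in the leaves. *)
Definition scaling (lambda : R) : 'M[R]_2 := mx22 lambda 0 0 lambda^-1.

Lemma det_scaling lambda : lambda != 0 -> \det (scaling lambda) = 1.
Proof. by move=> l0; rewrite det22 !mxE/= mul0r subr0 divff. Qed.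

Lemma mul_scalingE M lambda :
  [/\ (M *m scaling lambda) 0 0 = M 0 0 * lambda,
      (M *m scaling lambda) 0 1 = M 0 1 / lambda,
      (M *m scaling lambda) 1 0 = M 1 0 * lambda &
      (M *m scaling lambda) 1 1 = M 1 1 / lambda].
Proof. by split; rewrite mxE sum_ord2 !mxE/=; ring. Qed.

Lemma fnorm2_mul_scaling M lambda : fnorm2 (M *m scaling lambda) =
  (M 0 0 ^+ 2 + M 1 0 ^+ 2) * lambda ^+ 2 +
  (M 0 1 ^+ 2 + M 1 1 ^+ 2) / lambda ^+ 2.
Proof.
have [E00 E01 E10 E11] := mul_scalingE M lambda.
by rewrite /fnorm2 E00 E01 E10 E11 -exprVn; ring.
Qed.

Lemma node_flow_le p q y a b : p <= q -> a <= b ->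
  flows_on (mx22 (- p) 0 0 (- q)) y a b ->
  enorm (y b) <= expR (- p * (b - a)) * enorm (y a).
Proof.
move=> pq ab /diag_flowE -> //; have : 0 <= b - a by rewrite subr_ge0.
move: (b - a) => s s0.
rewrite -(ler_pXn2r (n := 2)) ?nnegrE ?mulr_ge0 ?expR_ge0 ?enorm_ge0//.
rewrite exprMn !enormE !mulmx22E !mxE/= !mul0r add0r addr0.
rewrite !exprMn mulrDr lerD2l.
rewrite ler_wpM2r ?sqr_ge0// ler_pXn2r ?nnegrE ?expR_ge0// ler_expR.
by rewrite ler_wpM2r// lerN2.
Qed.

(** In the following lemmas M stands for P_j^-1 P_1, y for the state in the
    rescaled coordinates of the node, and L y for the state in the coordinates
    where the leaf is in normal form.  The term subtracted from p1 * tau is the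
    gain of leaving the leaf before time eta; it makes the decay strict when
    the switching times do not converge to the extreme ones. *)
Section Leaf.
Variables (M : 'M[R]_2) (p1 lambda eta a b : R) (y : R -> 'cV[R]_2).
Hypotheses (dM : \det M ^+ 2 = 1) (p1_gt0 : 0 < p1) (l_gt0 : 0 < lambda).
Hypotheses (ab : a <= b) (b_eta : b <= a + eta).
Let L := M *m scaling lambda.

Let dL : \det L ^+ 2 = 1.
Proof. by rewrite det_mulmx det_scaling ?lt0r_neq0// mulr1. Qed.

Let LK : invmx L *m L = 1%:M.
Proof. by rewrite mulVmx// unitmxE unitfE -sqrf_eq0 dL oner_neq0. Qed.

Let ba_eta : 0 <= b - a <= eta.
Proof. by rewrite subr_ge0 ab lerBlDl. Qed.

Lemma spiral_leaf_le alpha beta :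
  flows_on (mx22 alpha beta (- beta) alpha) (fun t => L *m y t) a b ->
  enorm (y b) <=
  expR (p1 * tau_complex p1 alpha M lambda eta -
        alpha * (eta - (b - a))) * enorm (y a).
Proof.
move=> /(spiral_flowE ab) /(conj_similarity_le dL).
rewrite mulmxA LK mul1mx fnorm2_mul_scaling => /le_trans; apply.
rewrite ler_wpM2r ?enorm_ge0// ler_expR /tau_complex.
move: (arcosh _) => r; rewrite -subr_ge0 (_ : _ - _ = 0)//.
by field; exact: lt0r_neq0.
Qed.

Lemma jordan_leaf_le n :
  flows_on (mx22 n 1 0 n) (fun t => L *m y t) a b ->
  enorm (y b) <=
  expR (p1 * tau_jordan p1 n M lambda eta - n * (eta - (b - a))) * enorm (y a).
Proof.
move=> /(jordan_flowE ab) zE.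
have := conj_jordan_flow_le n (y a) dL ba_eta.
rewrite -zE mulmxA LK mul1mx => /le_trans; apply.
rewrite ler_wpM2r ?enorm_ge0// ler_expR /tau_jordan.
have [_ _ -> ->] := mul_scalingE M lambda; rewrite !exprMn exprVn.
move: (arsinh _) => r; rewrite -subr_ge0 (_ : _ - _ = 0)//.
by field; exact: lt0r_neq0.
Qed.

Lemma diag_leaf_le p q : 0 < eta -> p <= q ->
  flows_on (mx22 p 0 0 q) (fun t => L *m y t) a b ->
  enorm (y b) <=
  expR (p1 * tau_diag p1 p q M lambda eta - q * (eta - (b - a))) * enorm (y a).
Proof.
move=> eta_gt0 pq /(diag_flowE ab) zE.
have [tau [tauE _]] := tau_diag_unique M lambda p1_gt0 pq eta_gt0.
have : tau_diag_eq p1 p q M lambda eta (tau_diag p1 p q M lambda eta).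
  apply: (@xgetPex _ 0 [set tau | tau_diag_eq p1 p q M lambda eta tau]).
  by exists tau.
move: (tau_diag _ _ _ _ _ _) => {tauE}tau [tau_ge tauE].
pose r := p1 * tau - (p + q) / 2 * eta.
have vr : (q - p) / 2 * eta <= r.
  by move: tau_ge; rewrite mulrAC ler_pdivrMr// /r => h; lra.
have rE : sinh r ^+ 2 = (1 + (L 0 0 * L 1 0 + L 0 1 * L 1 1) ^+ 2) *
                        sinh ((q - p) / 2 * eta) ^+ 2.
  have -> : L 0 0 * L 1 0 + L 0 1 * L 1 1 =
      M 0 1 * M 1 1 / lambda ^+ 2 + M 0 0 * M 1 0 * lambda ^+ 2.
    by have [-> -> -> ->] := mul_scalingE M lambda; rewrite -exprVn; ring.
  have := sinhB_sinhD r ((q - p) / 2 * eta).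
  have -> : r - (q - p) / 2 * eta = p1 * tau - q * eta by rewrite /r; field.
  have -> : r + (q - p) / 2 * eta = p1 * tau - p * eta by rewrite /r; field.
  by rewrite tauE => /eqP; rewrite eq_sym subr_eq => /eqP ->; ring.
have := conj_diag_flow_le (y a) dL pq ba_eta vr rE.
by rewrite -zE mulmxA LK mul1mx /r addrCA subrr addr0.
Qed.

End Leaf.
End LeafGrowth.

(** * Concatenation of the cycles *)

Section Cycles.
Context {R : realType} {m : nat}.
Implicit Types (sigma : R -> 'I_m.+1) (d : nat -> R) (A : 'I_m.+1 -> 'M[R]_2).

Lemma switching_times_homo sigma d : switching_times sigma d ->
  {homo d : i j / (i <= j)%N >-> i <= j}.
Proof.
move=> [_ dS _ _ _]; apply: homo_leq => //; first exact: le_trans.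
by move=> i; exact: ltW.
Qed.

Lemma switching_cycle sigma d i t : switching_times sigma d ->
  d (2 * i)%N <= t ->
  exists2 j, (i <= j)%N & d (2 * j)%N <= t <= d (2 * j.+1)%N.
Proof.
move=> sd it; have dhomo := switching_times_homo sd; have [_ _ dcvg _ _] := sd.
have [n tn] : exists n, t < d (2 * n)%N.
  have [n _ dn] := (cvgryPgt d).1 dcvg t.
  by exists n; apply: dn => /=; rewrite leq_pmull.
have ex : exists n, t < d (2 * n)%N by exists n.
case: (ex_minnP ex) => -[|j] tj minj.
  have : d (2 * 0)%N <= t by apply: le_trans it; exact: dhomo.
  by rewrite leNgt tj.
exists j; last first.
  rewrite (ltW tj) andbT leNgt; apply/negP => /minj.
  by rewrite ltnn.
rewrite -ltnS ltnNge; apply/negP => ji.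
have : d (2 * j.+1)%N <= t.
  by apply: le_trans it; apply: dhomo; rewrite leq_mul2l.
by rewrite leNgt tj.
Qed.

(** Here f measures the state in the good norm.  Over one cycle it decreases by
    the factor exp (- c * slack), where the slack is the distance between
    (t_k, s_k) and (tau, eta). *)
Section Decay.
Variables (sigma : R -> 'I_m.+1) (d : nat -> R) (tau eta c K : R) (f : R -> R).
Hypothesis sig : signal_with tau eta sigma d.
Hypotheses (c_gt0 : 0 < c) (K_ge0 : 0 <= K) (f_ge0 : forall t, 0 <= f t).

Let slack i := (dwell d i - tau) + (eta - flee d i).

Hypothesis cycle_decay : forall i,
  f (d (2 * i.+1)%N) <= expR (- (c * slack i)) * f (d (2 * i)%N).
Hypothesis cycle_bound : forall i t, d (2 * i)%N <= t <= d (2 * i.+1)%N ->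
  f t <= K * f (d (2 * i)%N).

Let slack_ge0 i : 0 <= slack i.
Proof.
have [_ _ /(_ i) [h1 h2]] := sig.
by rewrite addr_ge0// subr_ge0.
Qed.

Let f_slack_sum i : f (d (2 * i)%N) <= expR (- (c * series slack i)) * f 0.
Proof.
have [[d0 _ _ _ _] _ _] := sig.
elim: i => [|i IH].
  by rewrite muln0 d0 /series/= big_geq// mulr0 oppr0 expR0 mul1r.
apply: le_trans (cycle_decay i) _.
have -> : - (c * series slack i.+1) = - (c * slack i) - c * series slack i.
  by rewrite seriesSr; ring.
rewrite expRD -[leRHS]mulrA.
by rewrite ler_wpM2l ?expR_ge0.
Qed.

Let slack_sum_homo : {homo series slack : i j / (i <= j)%N >-> i <= j}.
Proof. by apply/nondecreasing_seqP => i; rewrite seriesSr lerDl. Qed.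

Let slack_sum_ge0 i : 0 <= series slack i.
Proof.
by apply: le_trans (slack_sum_homo (leq0n i)); rewrite /series/= big_geq.
Qed.

Lemma cycles_bounded t : 0 <= t -> f t <= K * f 0.
Proof.
move=> t0; have [sd _ _] := sig; have [d0 _ _ _ _] := sd.
have [|j _ /cycle_bound ft] := @switching_cycle sigma d 0 t sd.
  by rewrite muln0 d0.
apply: le_trans ft _; rewrite ler_wpM2l//.
apply: le_trans (f_slack_sum j) _; rewrite ler_piMl//.
by rewrite -expR0 ler_expR oppr_le0 mulr_ge0// ltW.
Qed.

(** If the sum of the slacks converged, the slacks would tend to 0, that is,
    (t_k, s_k) would tend to (tau, eta).  Being nonnegative, they otherwise sum
    up to infinity, which drives f to 0. *)
Lemma cycles_vanish :
  ~ ((dwell d i, flee d i) @[i --> \oo] --> (tau, eta)) ->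
  f t @[t --> +oo] --> (0 : R).
Proof.
move=> ncv; have [sd _ tdw] := sig.
have dhomo := switching_times_homo sd.
have sumoo : series slack @ \oo --> +oo.
  apply: nondecreasing_dvgn_lt => // /cvg_series_cvg_0 slack0.
  have squeezed (g : nat -> R) :
      (forall i, 0 <= g i <= slack i) -> g @ \oo --> (0 : R).
    by move=> gs; apply: (squeeze_cvgr _ (cvg_cst 0) slack0); exact: nearW.
  have dwell_cvg : dwell d @ \oo --> tau.
    rewrite (_ : dwell d = fun i => dwell d i - tau + tau); last first.
      by apply/funext => i; rewrite subrK.
    rewrite -[X in _ --> X]add0r; apply: cvgD; last exact: cvg_cst.
    apply: squeezed => i; have [h1 h2] := tdw i.
    by rewrite subr_ge0 h1/= /slack lerDl subr_ge0.
  have flee_cvg : flee d @ \oo --> eta.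
    rewrite (_ : flee d = fun i => eta - (eta - flee d i)); last first.
      by apply/funext => i; rewrite subKr.
    rewrite -[X in _ --> X]subr0; apply: cvgB; first exact: cvg_cst.
    apply: squeezed => i; have [h1 h2] := tdw i.
    by rewrite subr_ge0 h2/= /slack lerDr subr_ge0.
  exact: ncv (cvg_pair dwell_cvg flee_cvg).
have bound0 :
    K * (expR (- (c * series slack i)) * f 0) @[i --> \oo] --> (0 : R).
  have expoo : expR (- (c * t)) @[t --> +oo] --> (0 : R).
    exact: (cvg_comp _ _ (gt0_cvgMry c_gt0 cvg_id) (@cvgr_expR R)).
  rewrite [X in _ --> X](_ : 0 = K * (0 * f 0)); last by rewrite mul0r mulr0.
  apply: cvgM; first exact: cvg_cst.
  by apply: cvgM; [exact: (cvg_comp _ _ sumoo expoo)|exact: cvg_cst].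
apply/cvgrPdist_le => e e0.
have [i _ /(_ i (leqnn i))/= fi] := (cvgrPdist_le _ _).1 bound0 e e0.
exists (d (2 * i)%N); split; first exact: num_real.
move=> t /ltW it; have [j ij /cycle_bound ft] := switching_cycle sd it.
rewrite sub0r normrN ger0_norm//; apply: le_trans ft _.
apply: le_trans fi; rewrite sub0r normrN ger0_norm ?mulr_ge0 ?expR_ge0//.
rewrite ler_wpM2l//; apply: le_trans (f_slack_sum j) _.
by rewrite ler_wpM2r// ler_expR lerN2 ler_pM2l// slack_sum_homo.
Qed.

End Decay.

Lemma solution_flows_on A sigma d x i :
  switching_times sigma d -> solution A sigma x ->
  flows_on (A (sigma (d i))) x (d i) (d i.+1).
Proof.
move=> sd [xc xd] r; have dhomo := switching_times_homo sd.
have [d0 _ _ sconst _] := sd.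
have di0 : 0 <= d i by rewrite -d0 dhomo.
split.
  have xc' : {within `[d i, d i.+1], continuous x}.
    apply: continuous_subspaceW xc => t /=.
    rewrite !in_itv/= andbT => /andP[dit _].
    exact: le_trans dit.
  move=> t; exact: (cvg_comp _ _ (xc' t) (@coord_continuous R 2 1 r 0 (x t))).
move=> t /andP[dit tdi]; rewrite -(sconst i t) ?(ltW dit)//.
apply: is_derive_coord; apply: xd; first exact: le_lt_trans dit.
have : t \in `]d i, d i.+1[ by rewrite in_itv/= dit.
move=> /near_in_itvoo; apply: filterS => s; rewrite in_itv/= => /andP[dis sdi].
by rewrite !(sconst i)// ?(ltW dit) ?(ltW dis).
Qed.

End Cycles.

(** A minimizing lambda does if there is one; otherwise eps leaves room above the
    infimum. *)
Lemma inf_or_eps_ge (R : realType) (eps : R) (f : R -> R) : 0 < eps ->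
  (forall lambda, 0 < lambda -> 0 <= f lambda) ->
  exists2 lambda, 0 < lambda & f lambda <= inf_or_eps eps f.
Proof.
move=> eps0 f0; rewrite /inf_or_eps.
case: asboolP => [[lambda l0 fl]|_]; first by exists lambda; rewrite // fl.
set E := [set f lambda | lambda in _].
have Einf : has_inf E.
  split; first by exists (f 1), 1 => //=; exact: ltr01.
  by exists 0 => _ [lambda l0 <-]; exact: f0.
have [_ [lambda l0 <-] fl] := inf_adherent eps0 Einf.
by exists lambda => //; exact: ltW.
Qed.

(** * Stability criterion for star-governed signals *)

Section StarCriterion.
Context {R : realType} {m : nat}.
(** T is a change of coordinates common to all subsystems.  The norm of T x must
    decrease at rate p1 in the node; in a leaf it may grow up to the factor
    exp (p1 * tau), which a stay of length tau in the node compensates. *)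
Variables (A : 'I_m.+1 -> 'M[R]_2) (T : 'M[R]_2) (p1 g tau eta : R).
Hypotheses (Tu : T \in unitmx) (p1_gt0 : 0 < p1) (g_gt0 : 0 < g).
Hypothesis node : forall x a b, a <= b -> flows_on (A ord0) x a b ->
  enorm (T *m x b) <= expR (- p1 * (b - a)) * enorm (T *m x a).
Hypothesis leaf : forall j x a b, j != ord0 -> a <= b -> b <= a + eta ->
  flows_on (A j) x a b ->
  enorm (T *m x b) <= expR (p1 * tau - g * (eta - (b - a))) * enorm (T *m x a).

Let c := Num.min p1 g.

Let c_gt0 : 0 < c.
Proof. by rewrite lt_min p1_gt0. Qed.

Let c_le_p1 : c <= p1.
Proof. by rewrite ge_min lexx. Qed.

Let c_le_g : c <= g.
Proof. by rewrite ge_min lexx orbT. Qed.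

Section Cycle.
Variables (sigma : R -> 'I_m.+1) (d : nat -> R) (x : R -> 'cV[R]_2).
Hypotheses (sig : signal_with tau eta sigma d) (xsol : solution A sigma x).

Let node_le i t : d (2 * i)%N <= t <= d (2 * i).+1 ->
  enorm (T *m x t) <=
  expR (- p1 * (t - d (2 * i)%N)) * enorm (T *m x (d (2 * i)%N)).
Proof.
move=> /andP[it ti]; have [sd star _] := sig; apply: node => //.
have := solution_flows_on (2 * i)%N sd xsol.
by rewrite (star i).1; exact: flows_onW.
Qed.

Let leaf_le i t : d (2 * i).+1 <= t <= d (2 * i.+1)%N ->
  enorm (T *m x t) <= expR (p1 * tau - g * (eta - (t - d (2 * i).+1))) *
                      enorm (T *m x (d (2 * i).+1)).
Proof.
rewrite mulnS => /andP[it ti]; have [sd star /(_ i) [_ hflee]] := sig.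
apply: (@leaf (sigma (d (2 * i).+1))) => //.
- by apply/eqP; exact: (star i).2.
- by rewrite -lerBlDl; apply: le_trans hflee; rewrite lerD2r.
- exact: flows_onW ti (solution_flows_on (2 * i).+1 sd xsol).
Qed.

Lemma star_cycle_decay i : enorm (T *m x (d (2 * i.+1)%N)) <=
  expR (- (c * (dwell d i - tau + (eta - flee d i)))) *
  enorm (T *m x (d (2 * i)%N)).
Proof.
have [sd _ /(_ i) [hdwell hflee]] := sig; have [_ dS _ _ _] := sd.
have := @leaf_le i (d (2 * i.+1)%N); rewrite mulnS lexx andbT ltW// => /(_ isT).
move=> /le_trans; apply.
have := @node_le i (d (2 * i).+1); rewrite lexx andbT ltW// => /(_ isT) h.
apply: le_trans (ler_wpM2l (expR_ge0 _) h) _.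
rewrite mulrA -expRD ler_wpM2r ?enorm_ge0// ler_expR.
rewrite -/(dwell d i) -/(flee d i).
have : 0 <= (p1 - c) * (dwell d i - tau) by rewrite mulr_ge0// subr_ge0.
have : 0 <= (g - c) * (eta - flee d i) by rewrite mulr_ge0// subr_ge0.
by lra.
Qed.

Lemma star_cycle_bound i t : d (2 * i)%N <= t <= d (2 * i.+1)%N ->
  enorm (T *m x t) <= (1 + expR (p1 * tau)) * enorm (T *m x (d (2 * i)%N)).
Proof.
have [sd _ /(_ i) [hdwell hflee]] := sig; have [_ dS _ _ _] := sd.
move=> /andP[it ti]; have E0 := enorm_ge0 (T *m x (d (2 * i)%N)).
have node1 s : d (2 * i)%N <= s <= d (2 * i).+1 ->
    enorm (T *m x s) <= enorm (T *m x (d (2 * i)%N)).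
  move=> si; apply: le_trans (node_le si) _; rewrite ler_piMl//.
  move/andP: si => [si _]; rewrite -expR0 ler_expR mulNr oppr_le0.
  by rewrite mulr_ge0 ?(ltW p1_gt0)// subr_ge0.
have [ti'|it'] := leP t (d (2 * i).+1).
  apply: le_trans (node1 t _) _; first by rewrite it.
  by rewrite ler_peMl// lerDl expR_ge0.
have lf := @leaf_le i t; rewrite ti (ltW it') in lf.
apply: le_trans (lf isT) _.
rewrite mulrDl mul1r -[leLHS]add0r; apply: lerD => //.
apply: ler_pM; rewrite ?expR_ge0 ?enorm_ge0//; last first.
  by apply: node1; rewrite lexx ltW.
rewrite ler_expR gerBl mulr_ge0 ?(ltW g_gt0)// subr_ge0.
by apply: le_trans hflee; rewrite mulnS in ti; rewrite lerD2r.
Qed.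

End Cycle.

Lemma star_stable sigma : signals tau eta sigma -> stable A sigma.
Proof.
move=> [d sig] e e0.
have [C C0 hC] := enorm_mul_bounded (invmx T).
have [D D0 hD] := enorm_mul_bounded T.
pose K := 1 + expR (p1 * tau).
have K0 : 0 < K by rewrite /K addr_gt0// expR_gt0.
have CKD : 0 < C * (K * D) by rewrite !mulr_gt0.
exists (e / (C * (K * D))); first exact: divr_gt0.
move=> x xsol; rewrite ltr_pdivlMr// => x0 t t0; apply: le_lt_trans x0.
have := hC (T *m x t); rewrite mulKmx// => /le_trans; apply.
rewrite mulrCA ler_wpM2l ?(ltW C0)// mulrCA.
apply: le_trans (_ : K * enorm (T *m x 0) <= _).
  apply: (cycles_bounded (f := fun t => enorm (T *m x t)) sig c_gt0 (ltW K0)).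
  - by move=> s; exact: enorm_ge0.
  - exact: star_cycle_decay sig xsol.
  - exact: star_cycle_bound sig xsol.
  - exact: ltW.
by rewrite ler_wpM2l ?(ltW K0)// mulrC.
Qed.

Lemma star_asymptotically_stable sigma :
  signals' tau eta sigma -> asymptotically_stable A sigma.
Proof.
move=> [d sig ncv]; split; first by apply: star_stable; exists d.
move=> x xsol; have [C C0 hC] := enorm_mul_bounded (invmx T).
have Tx0 : enorm (T *m x t) @[t --> +oo] --> (0 : R).
  apply: (cycles_vanish sig c_gt0 _ _ (star_cycle_decay sig xsol)
    (star_cycle_bound sig xsol) ncv).
  - by rewrite addr_ge0// expR_ge0.
  - by move=> t; exact: enorm_ge0.
have CTx0 : C * enorm (T *m x t) @[t --> +oo] --> (0 : R).
  rewrite [X in _ --> X](_ : 0 = C * 0); last by rewrite mulr0.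
  by apply: cvgM; [exact: cvg_cst|exact: Tx0].
apply: (squeeze_cvgr _ (cvg_cst 0) CTx0); apply: nearW => t.
by rewrite enorm_ge0/=; have := hC (T *m x t); rewrite mulKmx.
Qed.

End StarCriterion.

(** * Dwell times of the leaves *)

Section LeafOfStar.
Context {R : realType} {m : nat}.
Variables (k l : nat) (P J : 'I_m.+1 -> 'M[R]_2).
Variables (p q alpha beta n : 'I_m.+1 -> R).

(** Real part of the dominant eigenvalue of J_j. *)
Definition leaf_rate (j : 'I_m.+1) : R :=
  if (j <= k)%N then alpha j else if (j <= k + l)%N then n j else q j.

Variable j : 'I_m.+1.
Hypothesis jN0 : j != ord0.
Hypothesis hcomplex : (0 < j <= k)%N ->
  [/\ J j = mx22 (alpha j) (beta j) (- beta j) (alpha j), 0 <= alpha j &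
      beta j != 0].
Hypothesis hjordan : (k < j <= k + l)%N ->
  J j = mx22 (n j) 1 0 (n j) /\ 0 <= n j.
Hypothesis hdiag : (k + l < j)%N ->
  [/\ J j = mx22 (p j) 0 0 (q j), p j <= q j & (p j, q j) != (0, 0)].

Let j_gt0 : (0 < j)%N.
Proof. by rewrite lt0n; apply: contra jN0 => /eqP j0; apply/eqP/val_inj. Qed.

Lemma leaf_rate_gt0 : unstable (J j) -> 0 < leaf_rate j.
Proof.
rewrite /leaf_rate; case: leqP => jk.
  by have [|-> _ bj] := hcomplex; rewrite ?j_gt0// => /unstable_spiral; apply.
case: leqP => jkl.
  by have [|-> _] := hjordan; rewrite ?jk// => /unstable_upper[].
by have [|-> pq _] := hdiag; rewrite // => /unstable_upper[] //; lra.
Qed.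

Lemma leaf_flow_le Aj lambda eta x a b :
  P ord0 \in unitmx -> P j \in unitmx -> Aj = P j *m J j *m invmx (P j) ->
  \det (invmx (P j) *m P ord0) ^+ 2 = 1 ->
  0 < p ord0 -> 0 < lambda -> 0 < eta -> a <= b -> b <= a + eta ->
  flows_on Aj x a b ->
  enorm (invmx (P ord0 *m scaling lambda) *m x b) <=
  expR (p ord0 * tau12 k l p q alpha n P j lambda eta -
        leaf_rate j * (eta - (b - a))) *
  enorm (invmx (P ord0 *m scaling lambda) *m x a).
Proof.
move=> P0u Pju AjE dM p0 l0 eta0 ab ba xA.
set M := invmx (P j) *m P ord0; set Q := P ord0 *m scaling lambda.
have Qu : Q \in unitmx.
  by rewrite unitmx_mul P0u unitmxE det_scaling ?lt0r_neq0// unitr1.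
have zE : (fun t => M *m scaling lambda *m (invmx Q *m x t)) =
          (fun t => invmx (P j) *m x t).
  by apply/funext => t; rewrite /M -(mulmxA (invmx (P j))) -/Q -mulmxA mulKVmx.
have : flows_on (J j) (fun t => M *m scaling lambda *m (invmx Q *m x t)) a b.
  rewrite zE; apply: flows_on_mulmx xA.
  by rewrite AjE !mulmxA mulVmx// mul1mx.
rewrite /tau12 /leaf_rate -/M; case: leqP => jk.
  have [|-> _ _] := hcomplex; rewrite ?j_gt0//.
  exact: spiral_leaf_le.
case: leqP => jkl.
  by have [|-> _] := hjordan; rewrite ?jk//; exact: jordan_leaf_le.
by have [|-> pq _] := hdiag; rewrite //; exact: diag_leaf_le.
Qed.

End LeafOfStar.

Theorem theorem13p3 (R : realType) (m : nat) (k l : nat)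
  (A P J : 'I_m.+1 -> 'M[R]_2) (p q alpha beta n : 'I_m.+1 -> R)
  (eta eps : R)
  (hm : (0 < m)%N)
  (hP : forall j, P j \in unitmx)
  (hA : forall j, A j = P j *m J j *m invmx (P j))
  (hA1 : hurwitz_stable (A ord0))
  (hAj : forall j, j != ord0 -> unstable (A j))
  (hdet : forall j, j != ord0 ->
     \det (invmx (P j) *m P ord0) = 1 \/ \det (invmx (P j) *m P ord0) = -1)
  (hJ1 : J ord0 = mx22 (- p ord0) 0 0 (- q ord0))
  (hpq1 : 0 < p ord0 <= q ord0)
  (hkl : (k + l + 1 <= m.+1)%N)
  (hcomplex : forall j : 'I_m.+1, (0 < j <= k)%N ->
     [/\ J j = mx22 (alpha j) (beta j) (- beta j) (alpha j),
         0 <= alpha j & beta j != 0])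
  (hjordan : forall j : 'I_m.+1, (k < j <= k + l)%N ->
     J j = mx22 (n j) 1 0 (n j) /\ 0 <= n j)
  (hdiag : forall j : 'I_m.+1, (k + l < j)%N ->
     [/\ J j = mx22 (p j) 0 0 (q j), p j <= q j & (p j, q j) != (0, 0)])
  (heta : 0 < eta) (heps : 0 < eps) :
  let tau := inf_or_eps eps (fun lambda =>
    max_leaves (fun j => tau12 k l p q alpha n P j lambda eta)) in
  (forall sigma, signals tau eta sigma -> stable A sigma) /\
  (forall sigma, signals' tau eta sigma -> asymptotically_stable A sigma).
Proof.
move=> tau; have /andP[p0 pq0] := hpq1.
have [lambda l0 tau_ge] : exists2 lambda, 0 < lambda &
    max_leaves (fun j => tau12 k l p q alpha n P j lambda eta) <= tau.
  by apply: inf_or_eps_ge heps _ => lambda _; exact: bigmax_ge_id.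
(* The leaves are finitely many, so their rates have a common lower bound. *)
pose g := \big[Num.min/1]_(j | j != ord0) leaf_rate k l q alpha n j.
have g0 : 0 < g.
  apply: lt_bigmin => // j jN0.
  apply: (leaf_rate_gt0 jN0 (hcomplex j) (hjordan j) (hdiag j)).
  by apply: (unstable_conj (hP j)); rewrite -hA; exact: hAj.
pose Q := P ord0 *m scaling lambda.
have su : scaling lambda \in unitmx.
  by rewrite unitmxE det_scaling ?lt0r_neq0// unitr1.
have Qu : invmx Q \in unitmx by rewrite unitmx_inv unitmx_mul hP.
have node x a b : a <= b -> flows_on (A ord0) x a b ->
    enorm (invmx Q *m x b) <=
    expR (- p ord0 * (b - a)) * enorm (invmx Q *m x a).
  move=> ab xA; apply: (node_flow_le (y := fun t => invmx Q *m x t) pq0 ab).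
  apply: flows_on_mulmx xA; rewrite -hJ1 hA.
  have SJ : scaling lambda *m J ord0 = J ord0 *m scaling lambda.
    rewrite hJ1; apply/matrixP; apply: ord2P; apply: ord2P;
      by rewrite !mxE !sum_ord2 !mxE/=; ring.
  have SQ : scaling lambda *m invmx Q = invmx (P ord0).
    rewrite -[LHS](mulKmx (hP ord0)).
    by rewrite (mulmxA (P ord0)) mulmxV ?mulmx1// -unitmx_inv.
  have -> : P ord0 *m J ord0 *m invmx (P ord0) = Q *m (J ord0 *m invmx Q).
    by rewrite -SQ /Q !mulmxA -(mulmxA (P ord0) (J ord0)) -SJ !mulmxA.
  by rewrite mulKmx// -unitmx_inv.
have leaf j x a b : j != ord0 -> a <= b -> b <= a + eta ->
    flows_on (A j) x a b ->
    enorm (invmx Q *m x b) <=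
    expR (p ord0 * tau - g * (eta - (b - a))) * enorm (invmx Q *m x a).
  move=> jN0 ab ba xA.
  have dM : \det (invmx (P j) *m P ord0) ^+ 2 = 1.
    by case: (hdet j jN0) => ->; rewrite ?sqrrN expr1n.
  have := leaf_flow_le jN0 (hcomplex j) (hjordan j) (hdiag j) (hP _)
    (hP j) (hA j) dM p0 l0 heta ab ba xA.
  move=> /le_trans; apply; rewrite ler_wpM2r ?enorm_ge0// ler_expR lerB//.
    rewrite ler_wpM2l ?(ltW p0)//; apply: le_trans tau_ge.
    exact: (le_bigmax_cond _ (fun j => tau12 k l p q alpha n P j lambda eta)).
  rewrite ler_wpM2r//; first by rewrite subr_ge0 lerBlDl.
  exact: bigmin_le_cond.
split=> sigma.
- exact: star_stable Qu p0 g0 node leaf sigma.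
- exact: star_asymptotically_stable Qu p0 g0 node leaf sigma.
Qed.
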